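(* Every non-empty perfect subset of the space $\mathcal{G}$ of marked finitely generated groups that contains a dense subset (dense in that perfect set) consisting of finitely presented groups is quasi-isometrically diverse.
   Context: Space of marked groups: for $n\in\mathbb{N}=\{1,2,\ldots\}$ let $\mathcal{G}_n$ be the set of all pairs $(G,X)$, where $G$ is a group generated by an ordered $n$-tuple $X\in G^n$, up to the equivalence: $(G,(x_1,\ldots,x_n))$ and $(H,(y_1,\ldots,y_n))$ are equivalent if the map $x_i\mapsto y_i$ extends to an isomorphism $G\to H$. Associating to $(G,X)$ the kernel of the homomorphism $F_n\to G$ sending a fixed basis of the free group $F_n$ to $X$ identifies $\mathcal{G}_n$ with the set of normal subgroups of $F_n$; $\mathcal{G}_n$ carries the topology induced by the product topology on $2^{F_n}$. The map $(G,(x_1,\ldots,x_n))\mapsto(G,(x_1,\ldots,x_n,1))$ identifies $\mathcal{G}_n$ with a clopen subspace of $\mathcal{G}_{n+1}$, and $\mathcal{G}=\bigcup_{n\in\mathbb{N}}\mathcal{G}_n$ is the topological union: $U\subseteq\mathcal{G}$ is open if and only if $U=\bigcup_n U_n$ with each $U_n$ open in $\mathcal{G}_n$. A subset of a topological space is perfect if it is closed and has no isolated points. Quasi-isometry: metric spaces $(S,d_S)$, $(T,d_T)$ are quasi-isometric if there are a constant $C$ and maps $\varphi\colon S\to T$, $\psi\colon T\to S$ such that $d_T(\varphi(x),\varphi(y))\le C d_S(x,y)+C$ for all $x,y\in S$, $d_S(\psi(x),\psi(y))\le C d_T(x,y)+C$ for all $x,y\in T$, $\sup_{t\in T}d_T(\varphi(\psi(t)),t)\le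 C$ and $\sup_{s\in S}d_S(\psi(\varphi(s)),s)\le C$. Marked groups $(G,X)$, $(H,Y)$ are quasi-isometric if $G$ and $H$ with the word metrics with respect to $X$ and $Y$ are quasi-isometric. A subset of a topological space is comeagre if it is the intersection of countably many subsets with dense interiors. A subset $\mathcal{S}\subseteq\mathcal{G}$ is quasi-isometrically diverse if every comeagre subset of $\mathcal{S}$ (with the subspace topology) has $2^{\aleph_0}$ quasi-isometry classes, i.e. contains groups from $2^{\aleph_0}$ distinct quasi-isometry classes. *)

(* Defs.v *)
From HB Require Import structures.
From mathcomp Require Import all_boot all_order all_algebra.
From mathcomp Require Import all_classical all_reals all_analysis.

Set Implicit Arguments.
Unset Strict Implicit.
Unset Printing Implicit Defensive.

Local Open Scope classical_set_scope.
Local Open Scope quotient_scope.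
Local Open Scope group_scope.

(* The letter (x, b) stands for x if b = false and for x^-1 if b = true. *)
Definition letter (T : Type) : Type := (T * bool)%type.

Section Words.
Variables (T : Type) (G : groupType) (X : T -> G).
Implicit Types (a : letter T) (s : seq (letter T)).

Definition inv_letter a : letter T := (a.1, ~~ a.2).

Definition letter_val a : G := if a.2 then (X a.1)^-1 else X a.1.

Definition word_val s : G := \prod_(a <- s) letter_val a.

Lemma inv_letterK : involutive inv_letter.
Proof. by case=> x b; rewrite /inv_letter /= negbK. Qed.

Lemma letter_val_inv a : letter_val (inv_letter a) = (letter_val a)^-1.
Proof. by rewrite /letter_val /=; case: a => x [] /=; rewrite ?invgK. Qed.

Lemma word_val_nil : word_val [::] = 1.
Proof. exact: big_nil. Qed.

Lemma word_val_cons a s : word_val (a :: s) = letter_val a * word_val s.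
Proof. exact: big_cons. Qed.

Lemma word_val_cat s t : word_val (s ++ t) = word_val s * word_val t.
Proof. exact: big_cat. Qed.

Lemma word_val_inv s : word_val (rev (map inv_letter s)) = (word_val s)^-1.
Proof.
elim: s => [|a s IHs] /=; first by rewrite word_val_nil invg1.
rewrite rev_cons -cats1 word_val_cat IHs word_val_cons word_val_nil.
by rewrite letter_val_inv mulg1 word_val_cons invgM.
Qed.

Definition generates := forall g : G, exists s, word_val s = g.

End Words.

Section FreeGroup.
Variable T : choiceType.
Implicit Types (a b : letter T) (s t u : seq (letter T)).

Definition reduced s := sorted (fun a b => b != inv_letter a) s.

Record free_group := FreeGroup { fg_word :> seq (letter T); _ : reduced fg_word }.

HB.instance Definition _ := [isSub for fg_word].
HB.instance Definition _ := [Choice of free_group by <:].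

(* Left multiplication of a reduced word by a letter. *)
Definition cons_letter a s :=
  if s is b :: s' then if b == inv_letter a then s' else a :: s else [:: a].

Lemma reduced_letter a s : reduced s -> reduced (cons_letter a s).
Proof.
case: s => [|b s] //= rs; case: eqP => [_|/eqP nba]; first exact: path_sorted rs.
by rewrite /= nba.
Qed.

Lemma reduced_foldr s t : reduced t -> reduced (foldr cons_letter t s).
Proof. by move=> rt; elim: s => //= a s; exact: reduced_letter. Qed.

Lemma cons_letterK a s :
  reduced s -> cons_letter a (cons_letter (inv_letter a) s) = s.
Proof.
case: s => [|b s] /= rs; first by rewrite eqxx.
rewrite inv_letterK; case: eqP => [eba|/eqP nba] /=; last by rewrite eqxx.
subst b; case: s rs => [|c s] //= /andP[ca _].
by rewrite (negbTE ca).
Qed.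

Lemma foldr_letter a s t : reduced s -> reduced t ->
  foldr cons_letter t (cons_letter a s) = cons_letter a (foldr cons_letter t s).
Proof.
case: s => [|b s] //= rs rt; case: eqP => [->|] //=.
by rewrite cons_letterK // reduced_foldr.
Qed.

Lemma foldr_reduced s : reduced s -> foldr cons_letter [::] s = s.
Proof.
elim: s => //= a s IHs rs; rewrite IHs; last exact: path_sorted rs.
by case: s rs {IHs} => [|b s] //= /andP[/negbTE-> _].
Qed.

Lemma reduced_inv s : reduced s -> reduced (rev (map (@inv_letter T) s)).
Proof.
rewrite /reduced rev_sorted sorted_map; apply: sub_sorted => a b /=.
by rewrite inv_letterK; apply: contraNneq => ->.
Qed.

Definition fg_one : free_group := @FreeGroup [::] isT.
Definition fg_mul (x y : free_group) : free_group :=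
  FreeGroup (reduced_foldr x (valP y)).
Definition fg_inv (x : free_group) : free_group :=
  FreeGroup (reduced_inv (valP x)).

Lemma fg_mulA : associative fg_mul.
Proof.
move=> [s rs] [t rt] [u ru]; apply/val_inj => /=; clear rs.
by elim: s => //= a s ->; rewrite foldr_letter // reduced_foldr.
Qed.

Lemma fg_mul1g : left_id fg_one fg_mul.
Proof. by move=> x; exact/val_inj. Qed.

Lemma fg_mulg1 : right_id fg_one fg_mul.
Proof. by move=> x; apply/val_inj; rewrite /= foldr_reduced ?(valP x). Qed.

Lemma fg_mulVg : left_inverse fg_one fg_inv fg_mul.
Proof.
move=> [s rs]; apply/val_inj => /=.
elim: s rs => //= a s IHs rs; rewrite rev_cons foldr_rcons /= inv_letterK eqxx.
by rewrite IHs //; exact: path_sorted rs.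
Qed.

Lemma fg_mulgV : right_inverse fg_one fg_inv fg_mul.
Proof.
have invK : involutive fg_inv.
  move=> x; apply/val_inj; rewrite /= map_rev revK -map_comp map_id_in // => a _.
  exact: inv_letterK.
by move=> x; rewrite -{1}(invK x) fg_mulVg.
Qed.

HB.instance Definition _ := isGroup.Build free_group
  fg_mulA fg_mul1g fg_mulg1 fg_mulVg fg_mulgV.

Definition fg_gen (x : T) : free_group := @FreeGroup [:: (x, false)] isT.

(* The homomorphism from the free group on T to G extending X. *)
Definition fg_eval (G : groupType) (X : T -> G) (w : free_group) : G :=
  word_val X w.

Section Eval.
Variables (G : groupType) (X : T -> G).

Lemma word_val_letter a s :
  word_val X (cons_letter a s) = letter_val X a * word_val X s.
Proof.
case: s => [|b s] /=; first by rewrite word_val_cons.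
case: eqP => [->|_]; last by rewrite word_val_cons.
by rewrite word_val_cons letter_val_inv mulVKg.
Qed.

Lemma word_val_foldr s t :
  word_val X (foldr cons_letter t s) = word_val X s * word_val X t.
Proof.
elim: s => [|a s IHs] /=; first by rewrite word_val_nil mul1g.
by rewrite word_val_letter IHs word_val_cons mulgA.
Qed.

Lemma fg_evalF : {morph fg_eval X : x y / x / y}.
Proof.
by move=> x y; rewrite /fg_eval /= word_val_foldr word_val_inv.
Qed.

HB.instance Definition _ := isGroupMorphism.Build _ _ (fg_eval X) fg_evalF.

Lemma fg_eval_gen x : fg_eval X (fg_gen x) = X x.
Proof. by rewrite /fg_eval word_val_cons word_val_nil mulg1. Qed.

End Eval.

Lemma val_word_val s : fg_word (word_val fg_gen s) = foldr cons_letter [::] s.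
Proof.
elim: s => [|a s IHs]; first by rewrite word_val_nil.
rewrite word_val_cons /= -IHs /letter_val.
by case: a => x [].
Qed.

Lemma fg_eval_id w : fg_eval fg_gen w = w.
Proof.
by apply/val_inj; rewrite /= val_word_val foldr_reduced ?(valP w).
Qed.

End FreeGroup.

Lemma morph_word_val (T : Type) (G H : groupType)
    (f : UMagmaMorphism.type G H) (X : T -> G) s :
  f (word_val X s) = word_val (f \o X) s.
Proof.
elim: s => [|a s IHs]; first by rewrite !word_val_nil gmulf1.
rewrite !word_val_cons gmulfM IHs /letter_val /=.
by case: ifP => _ //; rewrite gmulfV.
Qed.

Record marked_group (n : nat) := MarkedGroup {
  mg_group :> groupType;
  mg_gen : 'I_n -> mg_group;
  mg_generates : generates mg_gen }.

Definition marked_equiv n (M1 M2 : marked_group n) : Prop :=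
  exists f : M1 -> M2, [/\ {morph f : x y / x * y}, bijective f &
    forall i, f (mg_gen M1 i) = mg_gen M2 i].

Definition normal_subgroups (G : groupType) : set {ptws G -> bool} :=
  [set N | [/\ N 1, forall x y, N x -> N y -> N (x / y)
             & forall x y, N x -> N (x ^ y)]].
Arguments normal_subgroups : clear implicits.

(* The set of marked groups with n generators, each being identified with the
   kernel of the homomorphism defined on the free group. *)
Definition marked_space (n : nat) : topologicalType :=
  set_type (normal_subgroups (free_group 'I_n)).

Section NormalTheory.
Variables (G : groupType) (N : set_type (normal_subgroups G)).
Local Notation mem x := (set_val N x).

Lemma normal1 : mem 1. Proof. by case: (set_valP N). Qed.

Lemma normalF x y : mem x -> mem y -> mem (x / y).
Proof. by case: (set_valP N) => _ + _; apply. Qed.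

Lemma normalJ x y : mem x -> mem (x ^ y).
Proof. by case: (set_valP N) => _ _; apply. Qed.

Lemma normalV x : mem x -> mem x^-1.
Proof. by move=> Nx; rewrite -div1g; apply: normalF => //; exact: normal1. Qed.

Lemma normalM x y : mem x -> mem y -> mem (x * y).
Proof. by move=> Nx Ny; rewrite -(invgK y); apply: normalF => //; exact: normalV. Qed.

Definition coset_rel x y := set_val N (x^-1 * y).

Lemma coset_rel_refl : reflexive coset_rel.
Proof. by move=> x; rewrite /coset_rel mulVg normal1. Qed.

Lemma coset_rel_sym : symmetric coset_rel.
Proof.
by move=> x y; apply/idP/idP => /normalV; rewrite /coset_rel invgM invgK.
Qed.

Lemma coset_rel_trans : transitive coset_rel.
Proof.
move=> y x z Nxy Nyz; rewrite /coset_rel.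
by have := normalM Nxy Nyz; rewrite -mulgA mulVKg.
Qed.

Canonical coset_equiv := EquivRel coset_rel coset_rel_refl coset_rel_sym coset_rel_trans.

Definition quotient_group := {eq_quot coset_equiv}.
HB.instance Definition _ := Choice.on quotient_group.

Definition quot_class (x : G) : quotient_group := \pi x.

Lemma quot_classP x y : quot_class x = quot_class y <-> mem (x^-1 * y).
Proof. by split=> [/eqmodP|H]; last exact/eqmodP. Qed.

Definition quot_mul (a b : quotient_group) := quot_class (repr a * repr b).
Definition quot_inv (a : quotient_group) := quot_class (repr a)^-1.

Lemma repr_quot_class x : mem ((repr (quot_class x))^-1 * x).
Proof. by apply/quot_classP; rewrite /quot_class reprK. Qed.

Lemma quot_class_mul x y : quot_mul (quot_class x) (quot_class y) = quot_class (x * y).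
Proof.
apply/quot_classP; have := repr_quot_class y; have := repr_quot_class x.
set x' := repr _; set y' := repr _ => Nx Ny.
have := normalM (normalJ y' Nx) Ny.
by rewrite /conjg !invgM !mulgA mulgK.
Qed.

Lemma quot_class_inv x : quot_inv (quot_class x) = quot_class x^-1.
Proof.
apply/quot_classP; have := repr_quot_class x; set x' := repr _ => Nx.
have := normalJ x'^-1 (normalV Nx).
by rewrite /conjg !invgM !invgK -!mulgA mulgV mulg1.
Qed.

Lemma quot_class_surj a : exists x, a = quot_class x.
Proof. by exists (repr a); rewrite /quot_class reprK. Qed.

Lemma quot_mulA : associative quot_mul.
Proof.
move=> a b c; have [[x ->] [y ->] [z ->]] :=
  And3 (quot_class_surj a) (quot_class_surj b) (quot_class_surj c).
by rewrite !quot_class_mul mulgA.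
Qed.

Lemma quot_mul1g : left_id (quot_class 1) quot_mul.
Proof. by move=> a; have [x ->] := quot_class_surj a; rewrite quot_class_mul mul1g. Qed.

Lemma quot_mulg1 : right_id (quot_class 1) quot_mul.
Proof. by move=> a; have [x ->] := quot_class_surj a; rewrite quot_class_mul mulg1. Qed.

Lemma quot_mulVg : left_inverse (quot_class 1) quot_inv quot_mul.
Proof.
move=> a; have [x ->] := quot_class_surj a.
by rewrite quot_class_inv quot_class_mul mulVg.
Qed.

Lemma quot_mulgV : right_inverse (quot_class 1) quot_inv quot_mul.
Proof.
move=> a; have [x ->] := quot_class_surj a.
by rewrite quot_class_inv quot_class_mul mulgV.
Qed.

HB.instance Definition _ := isGroup.Build quotient_group
  quot_mulA quot_mul1g quot_mulg1 quot_mulVg quot_mulgV.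

Lemma quot_classF : {morph quot_class : x y / x / y}.
Proof. by move=> x y; rewrite -quot_class_mul -quot_class_inv. Qed.

HB.instance Definition _ := isGroupMorphism.Build _ _ quot_class quot_classF.

Lemma quot_class_eq1 x : (quot_class x == 1) = mem x.
Proof.
apply/eqP/idP => [/esym/quot_classP|Nx]; first by rewrite invg1 mul1g.
by apply/esym/quot_classP; rewrite invg1 mul1g.
Qed.

End NormalTheory.

Section Kernel.
Variables (n : nat).
Implicit Type M : marked_group n.

Lemma kernel_subproof M :
  normal_subgroups _ (fun w : free_group 'I_n => fg_eval (mg_gen M) w == 1).
Proof.
split=> [|x y /eqP x1 /eqP y1|x y /eqP x1]; first by rewrite gmulf1.
  by rewrite gmulfF /= x1 y1 divg1.
by rewrite /conjg !gmulfM gmulfV /= x1 mul1g mulVg.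
Qed.

Definition kernel M : marked_space n :=
  exist (fun N => N \in normal_subgroups (free_group 'I_n)) _
    (mem_set (kernel_subproof M)).

Lemma quotient_marked_subproof (N : marked_space n) :
  generates (fun i => quot_class N (fg_gen i)).
Proof.
move=> a; have [w ->] := quot_class_surj a; exists w.
by rewrite -[in RHS](fg_eval_id w) [in RHS]/fg_eval morph_word_val.
Qed.

Definition quotient_marked (N : marked_space n) : marked_group n :=
  MarkedGroup (@quotient_marked_subproof N).

Lemma quotient_markedK : cancel quotient_marked kernel.
Proof.
move=> N; apply/val_inj/funext => w /=; rewrite -[RHS]quot_class_eq1.
by rewrite -[in RHS](fg_eval_id w) [in RHS]/fg_eval morph_word_val.
Qed.

Lemma marked_equiv_eval M1 M2 (f : M1 -> M2) :
    {morph f : x y / x * y} -> (forall i, f (mg_gen M1 i) = mg_gen M2 i) ->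
  forall w, f (fg_eval (mg_gen M1) w) = fg_eval (mg_gen M2) w.
Proof.
move=> fM fX w.
have f1 : f 1 = 1 by apply: (@mulgI _ (f 1)); rewrite -fM !mulg1.
have fF : {morph f : x y / x / y}.
  by move=> x y; apply: (@mulIg _ (f y)); rewrite -fM !divgK.
pose f' : UMagmaMorphism.type M1 M2 := HB.pack f (isGroupMorphism.Build _ _ f fF).
rewrite /fg_eval -[f]/(f' : _ -> _) morph_word_val; congr word_val.
exact/funext.
Qed.

Lemma fg_eval_surj M g : exists w, fg_eval (mg_gen M) w = g.
Proof.
have [s <-] := mg_generates g; exists (word_val (@fg_gen 'I_n) s).
rewrite morph_word_val; congr word_val; apply/funext => i /=.
exact: fg_eval_gen.
Qed.

Lemma kernel_eqP M1 M2 : kernel M1 = kernel M2 <-> marked_equiv M1 M2.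
Proof.
split=> [E|[f [fM [f' fK _] fX]]]; last first.
  apply/val_inj/funext => w /=.
  rewrite -(marked_equiv_eval fM fX) -(inj_eq (can_inj fK)).
  by congr (_ == _); apply: (@mulgI _ (f 1)); rewrite -fM !mulg1.
have E1 w : (fg_eval (mg_gen M1) w == 1) = (fg_eval (mg_gen M2) w == 1).
  by have /(congr1 (fun N => set_val N w)) := E.
have F12 w w' : fg_eval (mg_gen M1) w = fg_eval (mg_gen M1) w' <->
                fg_eval (mg_gen M2) w = fg_eval (mg_gen M2) w'.
  have := E1 (w / w'); rewrite !gmulfF /= => E'.
  split=> H.
    by apply/eqP; rewrite -divg_eq1 -E' H divgg.
  by apply/eqP; rewrite -divg_eq1 E' H divgg.
pose w1 g := sval (cid (fg_eval_surj (M := M1) g)).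
have w1K g : fg_eval (mg_gen M1) (w1 g) = g by rewrite /w1; case: cid.
pose w2 g := sval (cid (fg_eval_surj (M := M2) g)).
have w2K g : fg_eval (mg_gen M2) (w2 g) = g by rewrite /w2; case: cid.
exists (fun g => fg_eval (mg_gen M2) (w1 g)); split=> [x y||i].
- by rewrite -gmulfM /=; apply/F12; rewrite gmulfM /= !w1K.
- exists (fun g => fg_eval (mg_gen M1) (w2 g)) => g.
    by rewrite -[RHS]w1K; apply/F12; rewrite w2K.
  by rewrite -[RHS]w2K; apply/F12; rewrite w1K.
- by rewrite -[RHS]fg_eval_gen; apply/F12; rewrite w1K fg_eval_gen.
Qed.

End Kernel.

(* Keeps the common generators of the two free groups and sends the remaining
   generators of the source to 1. *)
Definition change_gens (m n : nat) : free_group 'I_n -> free_group 'I_m :=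
  fg_eval (fun i : 'I_n =>
    if insub (val i) is Some j then fg_gen (j : 'I_m) else 1).

HB.instance Definition _ m n := isGroupMorphism.Build _ _ (@change_gens m n)
  (fg_evalF _).

Lemma change_gens_normal m n (N : marked_space m) :
  normal_subgroups _ (fun w : free_group 'I_n => set_val N (change_gens m w)).
Proof.
split=> [|x y|x y]; first by rewrite gmulf1 normal1.
  by rewrite gmulfF; exact: normalF.
by rewrite /conjg !gmulfM gmulfV; exact: normalJ.
Qed.

(* For m <= n, this is the embedding that sends (G, (x_1, ..., x_m)) to
   (G, (x_1, ..., x_m, 1, ..., 1)). *)
Definition pad (m n : nat) (N : marked_space m) : marked_space n :=
  exist (fun N => N \in normal_subgroups (free_group 'I_n)) _
    (mem_set (@change_gens_normal m n N)).

Lemma padE m n (N : marked_space m) (w : free_group 'I_n) :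
  set_val (pad n N) w = set_val N (change_gens m w).
Proof. by []. Qed.

Lemma fg_eval_morph (T : choiceType) (G H : groupType)
    (f : UMagmaMorphism.type G H) (X : T -> G) w :
  f (fg_eval X w) = fg_eval (f \o X) w.
Proof. exact: morph_word_val. Qed.

Lemma change_gens_id n (w : free_group 'I_n) : change_gens n w = w.
Proof.
rewrite -[RHS]fg_eval_id /change_gens; congr fg_eval; apply/funext => i.
by rewrite valK.
Qed.

Lemma change_gens_comp a b c (w : free_group 'I_c) : (a <= b)%N || (c <= b)%N ->
  change_gens a (change_gens b w) = change_gens a w.
Proof.
move=> abc; rewrite [change_gens b w]/change_gens.
rewrite (fg_eval_morph (fg_eval _)) /change_gens; congr fg_eval.
apply/funext => i /=; case: insubP => [j _ ji|nib].
  by rewrite fg_eval_gen ji.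
rewrite gmulf1 insubF //; apply: contraNF nib => ia.
by case/orP: abc; exact: leq_trans.
Qed.

Lemma pad_id n (N : marked_space n) : pad n N = N.
Proof. by apply/val_inj/funext => w /=; rewrite change_gens_id. Qed.

Lemma pad_comp a b c (N : marked_space a) : (a <= b)%N || (c <= b)%N ->
  pad c (pad b N) = pad c N.
Proof. by move=> abc; apply/val_inj/funext => w /=; rewrite padE change_gens_comp. Qed.

Lemma padK m n : (m <= n)%N -> cancel (@pad m n) (@pad n m).
Proof. by move=> mn N; rewrite pad_comp ?mn // pad_id. Qed.

Lemma marked_mem_continuous n (w : free_group 'I_n) :
  continuous (fun N : marked_space n => set_val N w).
Proof.
move=> N; apply: (@continuous_comp _ {ptws free_group 'I_n -> bool} _ set_val
  (fun f : {ptws free_group 'I_n -> bool} => f w)).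
  exact: initial_continuous.
exact: (@proj_continuous _ (fun=> bool)).
Qed.

Lemma pad_continuous m n : continuous (@pad m n).
Proof.
apply: continuous_comp_initial => N.
have FF : Filter (nbhs ((set_val \o @pad m n) x @[x --> N])).
  exact: (fmap_filter _ (nbhs_filter N)).
apply/cvg_sup => w U.
case=> _ [[/= W oW <-] /= WN] /filterS; apply.
apply: (@marked_mem_continuous m (change_gens m w) N).
exact: open_nbhs_nbhs.
Qed.

(* The index n stands for n + 1 generators. *)
Definition marked_sum : choiceType := {n : nat & marked_space n.+1}.

Definition same_marked (p q : marked_sum) : bool :=
  let k := maxn (tag p).+1 (tag q).+1 in
  pad k (tagged p) == pad k (tagged q).

Lemma same_markedP (p q : marked_sum) k : (tag p < k)%N -> (tag q < k)%N ->
  same_marked p q = (pad k (tagged p) == pad k (tagged q)).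
Proof.
move=> pk qk; rewrite /same_marked; set l := maxn _ _.
have [pl ql] : (tag p < l /\ tag q < l)%N by rewrite leq_maxl leq_maxr.
have lk : (l <= k)%N by rewrite geq_max pk.
rewrite -(pad_comp (c := k) (b := l)) ?pl // -[X in _ = (_ == X)](pad_comp (c := k) (b := l)) ?ql //.
by rewrite (inj_eq (can_inj (padK lk))).
Qed.

Lemma same_marked_refl : reflexive same_marked.
Proof. by move=> p; exact: eqxx. Qed.

Lemma same_marked_sym : symmetric same_marked.
Proof. by move=> p q; rewrite /same_marked maxnC eq_sym. Qed.

Lemma same_marked_trans : transitive same_marked.
Proof.
move=> q p r; pose k := (maxn (tag q) (maxn (tag p) (tag r))).+1.
have [pk qk rk] : [/\ tag p < k, tag q < k & tag r < k]%N.
  by rewrite !ltnS !leq_max !leqnn !orbT.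
by rewrite !(same_markedP (k := k)) // => /eqP->.
Qed.

Canonical same_marked_equiv :=
  EquivRel same_marked same_marked_refl same_marked_sym same_marked_trans.

Definition marked_groups := {eq_quot same_marked_equiv}.
HB.instance Definition _ := Choice.on marked_groups.

Definition marked_incl (n : nat) (N : marked_space n.+1) : marked_groups :=
  \pi_marked_groups (Tagged (fun n => marked_space n.+1) N).

Lemma marked_incl_eqP m n (M : marked_space m.+1) (N : marked_space n.+1) :
  marked_incl M = marked_incl N <->
  M = pad m.+1 N /\ pad n.+1 (pad m.+1 N) = N.
Proof.
pose F n : Type := marked_space n.+1.
pose p : marked_sum := Tagged F M; pose q : marked_sum := Tagged F N.
have -> : marked_incl M = marked_incl N <-> same_marked p q.
  by split=> [/eqmodP|H] //; exact/eqmodP.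
have [mn|/ltnW nm] := leqP m n.
  rewrite (same_markedP (k := n.+1)) //= pad_id; split=> [/eqP <-|[-> ->] //].
  by rewrite padK.
rewrite (same_markedP (k := m.+1)) //= pad_id; split=> [/eqP ->|[-> _] //].
by rewrite padK.
Qed.

Lemma marked_incl_inj n : injective (@marked_incl n).
Proof. by move=> M N /marked_incl_eqP[-> _]; rewrite pad_id. Qed.

Lemma marked_inclS n (N : marked_space n.+1) : marked_incl (pad n.+2 N) = marked_incl N.
Proof. by apply/marked_incl_eqP; rewrite padK. Qed.

Lemma marked_inclP (p : marked_groups) : exists n (N : marked_space n.+1), p = marked_incl N.
Proof.
exists (tag (repr p)), (tagged (repr p)).
by rewrite /marked_incl -[LHS]reprK; case: (repr p).
Qed.

Lemma pad_fixedP m n (N : marked_space n) :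
  pad n (pad m N) = N <-> forall i : 'I_n, (m <= i)%N -> set_val N (fg_gen i).
Proof.
have changeE (i : 'I_n) : change_gens n (change_gens m (fg_gen i)) =
    if (i < m)%N then fg_gen i else 1.
  rewrite /change_gens fg_eval_gen; case: insubP => [j -> ji|/negbTE->].
    by rewrite fg_eval_gen ji valK.
  by rewrite gmulf1.
split=> [NE i mi|H].
  by rewrite -NE !padE changeE ltnNge mi normal1.
have HN (w : free_group 'I_n) :
    quot_class N (change_gens n (change_gens m w)) = quot_class N w.
  have := fg_eval_morph (quot_class N \o (@change_gens n m \o @change_gens m n))
    (@fg_gen 'I_n) w.
  have := fg_eval_morph (quot_class N) (@fg_gen 'I_n) w.
  rewrite !fg_eval_id /= => -> ->; congr fg_eval; apply/funext => i /=.
  rewrite changeE.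
  case: ltnP => // mi; apply/quot_classP.
  by rewrite invg1 mul1g; exact: H.
apply/val_inj/funext => w /=.
by rewrite padE -quot_class_eq1 HN quot_class_eq1.
Qed.

Lemma pad_fixed_open m n : open [set N : marked_space n | pad n (pad m N) = N].
Proof.
rewrite openE => N /= /pad_fixedP NE.
pose Q (i : 'I_n) : set (marked_space n) :=
  [set M : marked_space n | (m <= i)%N -> set_val M (fg_gen i)].
have : nbhs N (fun M => forall i, Q i M).
  apply: (@filter_forall (marked_space n) _ Q (nbhs N) _) => i.
  case: (leqP m i) => mi; last by apply: nearW => M; rewrite /Q /= leqNgt mi.
  have := @marked_mem_continuous n (fg_gen i) N [set true].
  rewrite /= NE // => /(_ (discrete_set1 _)) /=.
  move=> H; apply: (@filterS _ (nbhs N) _ _ _ _ H) => M /= ME _; exact: ME.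
by apply: filterS => M /pad_fixedP.
Qed.

Definition marked_open (U : set marked_groups) : Prop :=
  exists2 Un : forall n, set (marked_space n.+1),
    forall n, open (Un n) & U = \bigcup_n (@marked_incl n @` Un n).

Lemma marked_openP U :
  marked_open U <-> forall n, open (@marked_incl n @^-1` U).
Proof.
split=> [[Un Uo ->] n|Uo]; last first.
  exists (fun n => @marked_incl n @^-1` U) => //; apply/seteqP; split=> p.
    by have [n [N ->]] := marked_inclP p => UN; exists n => //; exists N.
  by case=> n _ [N UN <-].
rewrite preimage_bigcup; apply: bigcup_open => m _.
rewrite (_ : _ @^-1` _ = [set N | pad n.+1 (pad m.+1 N) = N] `&`
                         @pad n.+1 m.+1 @^-1` Un m); last first.
  apply/seteqP; split=> N /=; first by case=> M UM /marked_incl_eqP[<- ->].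
  by case=> NE UN; exists (pad m.+1 N) => //; apply/marked_incl_eqP.
apply: openI; first exact: pad_fixed_open.
have /continuousP := @pad_continuous n.+1 m.+1; apply; exact: Uo.
Qed.

Lemma marked_openT : marked_open setT.
Proof. by apply/marked_openP => n; rewrite preimage_setT; exact: openT. Qed.

Lemma marked_openI : setI_closed marked_open.
Proof.
move=> U V /marked_openP Uo /marked_openP Vo; apply/marked_openP => n.
by rewrite preimage_setI; exact: openI.
Qed.

Lemma marked_open_bigU (I : Type) (f : I -> set marked_groups) :
  (forall i, marked_open (f i)) -> marked_open (\bigcup_i f i).
Proof.
move=> fo; apply/marked_openP => n; rewrite preimage_bigcup.
by apply: bigcup_open => i _; have /marked_openP := fo i; exact.
Qed.

HB.instance Definition _ := isOpenTopological.Build marked_groups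
  marked_openT marked_openI marked_open_bigU.

(* Representatives of a point with different numbers of generators only differ
   by trivial generators, so the choice made by repr is irrelevant below. *)
Definition marked_group_of (p : marked_groups) : marked_group (tag (repr p)).+1 :=
  quotient_marked (tagged (repr p)).

Definition normal_closure (G : groupType) (A : set G) : set G :=
  [set x | forall N : set_type (normal_subgroups G),
    (forall y, A y -> set_val N y) -> set_val N x].

Definition finitely_presented (G : groupType) : Prop :=
  exists (n : nat) (X : 'I_n -> G) (R : seq (free_group 'I_n)),
    generates X /\ [set w | fg_eval X w = 1] = normal_closure [set` R].

Section WordLength.
Variables (n : nat) (M : marked_group n).
Implicit Types g h : M.

Lemma word_length_subproof g :
  exists k, `[< exists2 s, size s = k & word_val (mg_gen M) s = g >].
Proof.
by have [s sg] := mg_generates g; exists (size s); apply/asboolP; exists s.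
Qed.

Definition word_length g : nat := ex_minn (word_length_subproof g).

Lemma word_lengthP g :
  exists2 s, size s = word_length g & word_val (mg_gen M) s = g.
Proof. by rewrite /word_length; case: ex_minnP => k /asboolP. Qed.

Lemma word_length_le s : (word_length (word_val (mg_gen M) s) <= size s)%N.
Proof.
by rewrite /word_length; case: ex_minnP => k _; apply; apply/asboolP; exists s.
Qed.

Lemma word_length1 : word_length 1 = 0%N.
Proof. by apply/eqP; rewrite -leqn0 -(word_val_nil (mg_gen M)); exact: word_length_le. Qed.

Lemma word_length_eq0 g : word_length g = 0%N -> g = 1.
Proof.
by have [s <- <-] := word_lengthP g => /size0nil ->; rewrite word_val_nil.
Qed.

Lemma word_lengthV_le g : (word_length g^-1 <= word_length g)%N.
Proof.
have [s <- <-] := word_lengthP g; rewrite -word_val_inv.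
by rewrite (leq_trans (word_length_le _)) // size_rev size_map.
Qed.

Lemma word_lengthV g : word_length g^-1 = word_length g.
Proof.
by apply/eqP; rewrite eqn_leq word_lengthV_le -{1}(invgK g) word_lengthV_le.
Qed.

Lemma word_lengthM g h : (word_length (g * h) <= word_length g + word_length h)%N.
Proof.
have [s <- <-] := word_lengthP g; have [t <- <-] := word_lengthP h.
by rewrite -word_val_cat (leq_trans (word_length_le _)) // size_cat.
Qed.

End WordLength.

(* Alias of M (R is a phantom parameter) carrying the word metric. *)
Definition word_space (R : realType) (n : nat) (M : marked_group n) : Type := M.

Section WordSpace.
Variables (R : realType) (n : nat) (M : marked_group n).

HB.instance Definition _ := Choice.on (word_space R M).

Definition word_dist (g h : word_space R M) : R :=
  (word_length ((g : M)^-1 * (h : M)))%:R%R.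

Lemma word_distxx g : word_dist g g = 0%R.
Proof. by rewrite /word_dist mulVg word_length1. Qed.

Lemma word_dist_eq0 g h : word_dist g h = 0%R -> g = h.
Proof.
move/eqP; rewrite Num.Theory.pnatr_eq0 => /eqP/word_length_eq0 gh.
by rewrite -[LHS](@mulg1 M) -gh (@mulVKg M).
Qed.

Lemma word_dist_sym g h : word_dist g h = word_dist h g.
Proof. by rewrite /word_dist -word_lengthV invgM invgK. Qed.

Lemma word_dist_triangle g h k :
  (word_dist h k <= word_dist h g + word_dist g k)%R.
Proof.
rewrite /word_dist -GRing.natrD Num.Theory.ler_nat.
by have := word_lengthM ((h : M)^-1 * g) ((g : M)^-1 * k); rewrite -mulgA mulVKg.
Qed.

HB.instance Definition _ := isMetric.Build R (word_space R M)
  word_distxx word_dist_eq0 word_dist_sym word_dist_triangle.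

End WordSpace.

Definition quasi_isometric (R : realType) (S T : metricType R) : Prop :=
  exists (C : R) (phi : S -> T) (psi : T -> S),
    [/\ forall x y, (mdist (phi x) (phi y) <= C * mdist x y + C)%R,
        forall x y, (mdist (psi x) (psi y) <= C * mdist x y + C)%R,
        forall t, (mdist (phi (psi t)) t <= C)%R
      & forall s, (mdist (psi (phi s)) s <= C)%R].

Definition qi_class (R : realType) (p : marked_groups) : set marked_groups :=
  [set q | quasi_isometric (word_space R (marked_group_of p))
                           (word_space R (marked_group_of q))].

Definition comeagre (T : topologicalType) (A : set T) : Prop :=
  exists2 F : nat -> set T, forall n, dense (F n)° & A = \bigcap_n F n.

Definition qi_diverse (R : realType) (S : set marked_groups) : Prop :=
  forall A : set (set_type S), comeagre A ->
    ([set qi_class R (set_val p) | p in A] #= [set: set nat])%card.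

(* Main.v *)
(* For fixed n, say that N is a coarse k-retract of M if there are coarsely
   k-Lipschitz maps phi : F_n/N -> F_n/M and psi back with psi o phi k-close to
   the identity; quasi-isometric groups are coarse k-retracts of each other for
   some k, and by compactness the relation is closed for each k. If M is finitely
   presented, then so is N, with relators of length bounded in terms of k and M
   only. If U x V were a product of non-empty open sets of the perfect set on
   which the relation held for some k, pick finitely presented points M1 in U and
   M2 in V: every point of U near M1 would then have relators shorter than the
   radius on which it agrees with M1, hence would equal M1, contradicting
   perfectness. So for each k the relation is closed with empty interior, and
   Mycielski's Cantor scheme yields, in any comeagre set, a Cantor set of points
   none of which is a coarse retract of another. *)

From HB Require Import structures.
Require Import Defs.
From mathcomp Require Import all_boot all_order all_algebra.
From mathcomp Require Import all_classical all_reals all_analysis.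
From mathcomp Require Import zify.

Set Implicit Arguments.
Unset Strict Implicit.
Unset Printing Implicit Defensive.

Local Open Scope classical_set_scope.
Local Open Scope group_scope.

(** * Groups defined by relators of bounded length *)

(** Short relations imply all others. Testing against every target [K] replaces the normal closure
    and allows a wreath product as a target. *)
Definition relator_bound (T : Type) (G : groupType) (X : T -> G) (r : nat) :=
  forall (K : groupType) (Z : T -> K),
    (forall s, (size s <= r)%N -> word_val X s = 1 -> word_val Z s = 1) ->
  forall s, word_val X s = 1 -> word_val Z s = 1.

Lemma word_val_reduced (T : choiceType) (G : groupType) (X : T -> G) s :
  fg_eval X (word_val (@fg_gen T) s) = word_val X s.
Proof.
rewrite morph_word_val; congr word_val; apply/funext => i /=.
exact: fg_eval_gen.
Qed.

(** The longest relator gives the bound: the kernel of [fg_eval Z] is normal, so it contains the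
    normal closure of [R] once it contains [R]. *)
Lemma relator_bound_presented (m : nat) (G : groupType) (X : 'I_m -> G)
    (R : seq (free_group 'I_m)) :
  [set w | fg_eval X w = 1] = normal_closure [set` R] ->
  exists r, relator_bound X r.
Proof.
move=> E; exists (\max_(w <- R) size (w : seq (letter 'I_m))) => K Z H s Xs.
have NZ : normal_subgroups (free_group 'I_m) (fun w => fg_eval Z w == 1).
  split=> [|x y /eqP x1 /eqP y1|x y /eqP x1]; first by rewrite gmulf1.
    by rewrite gmulfF /= x1 y1 divg1.
  by rewrite /conjg !gmulfM gmulfV /= x1 mul1g mulVg.
pose N : set_type (normal_subgroups (free_group 'I_m)) :=
  exist (fun N => N \in normal_subgroups (free_group 'I_m)) _ (mem_set NZ).
have : [set w | fg_eval X w = 1] (word_val (@fg_gen 'I_m) s).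
  by rewrite /= word_val_reduced.
rewrite E => /(_ N) sN; rewrite -word_val_reduced; apply/eqP/sN => w wR.
apply/eqP/H; first exact: (@leq_bigmax_seq _ R xpredT (fun w : free_group _ => size w)).
have : normal_closure [set` R] w by move=> M; apply.
by rewrite -E.
Qed.

(* The unrestricted wreath product of K by G; cocycles on the Cayley graph of G
   with values in K are homomorphisms to it. *)
Section Wreath.
Variables (K G : groupType).

Definition wreath : Type := ((G -> K) * G)%type.
HB.instance Definition _ := Choice.on wreath.

Implicit Types c d e : wreath.
Definition wreath_one : wreath := (fun=> 1, 1).
Definition wreath_mul c d : wreath := (fun x => c.1 x * d.1 (x * c.2), c.2 * d.2).
Definition wreath_inv c : wreath := (fun x => (c.1 (x * c.2^-1))^-1, c.2^-1).

Lemma wreath_mulA : associative wreath_mul.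
Proof.
move=> c d e; congr pair; last exact: mulgA.
by apply/funext => x /=; rewrite !mulgA.
Qed.

Lemma wreath_mul1g : left_id wreath_one wreath_mul.
Proof.
case=> c g; rewrite /wreath_mul /= mul1g; congr pair.
by apply/funext => x; rewrite mul1g mulg1.
Qed.

Lemma wreath_mulg1 : right_id wreath_one wreath_mul.
Proof.
case=> c g; rewrite /wreath_mul /= mulg1; congr pair.
by apply/funext => x; rewrite mulg1.
Qed.

Lemma wreath_mulVg : left_inverse wreath_one wreath_inv wreath_mul.
Proof.
case=> c g; rewrite /wreath_mul /= mulVg; congr pair.
by apply/funext => x; rewrite mulVg.
Qed.

Lemma wreath_mulgV : right_inverse wreath_one wreath_inv wreath_mul.
Proof.
case=> c g; rewrite /wreath_mul /= mulgV; congr pair.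
by apply/funext => x; rewrite mulgK mulgV.
Qed.

HB.instance Definition _ := isGroup.Build wreath
  wreath_mulA wreath_mul1g wreath_mulg1 wreath_mulVg wreath_mulgV.

End Wreath.

(** * Relator bounds pass to coarse retracts *)

Section CoarseRetract.
Variables (S T : Type) (G H : groupType) (X : S -> G) (Y : T -> H).
Variables (phi : H -> G) (psi : G -> H) (k : nat).
Hypothesis phi_lip : forall h a, exists2 s, (size s <= k)%N &
  phi (h * letter_val Y a) = phi h * word_val X s.
Hypothesis psi_lip : forall g x, exists2 t, (size t <= k)%N &
  psi (g * X x) = psi g * word_val Y t.
Hypothesis psi_phi : forall h, exists2 t, (size t <= k)%N &
  psi (phi h) = h * word_val Y t.

(* [k * r] bounds the image under [psi] of a loop of length [r]; the other terms
   bound a loop made of an edge of [H], the paths from its ends to their images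
   under [psi \o phi], and the image of the edge. *)
Definition retract_bound r := (k * r + k * k + k + k).+1.

(** Via [phi], a relation of [Y] becomes a closed path in [G]. Its lift to [K] through [psi] has
    trivial value, and up to conjugation this is the value of the original relation under [Z]. *)
Lemma relator_bound_retract r :
  relator_bound X r -> relator_bound Y (retract_bound r).
Proof.
move=> Xr K Z Zr.
pose u g x := s2val (cid2 (psi_lip g x)).
have u_size g x : (size (u g x) <= k)%N by rewrite /u; case: cid2.
have u_val g x : psi (g * X x) = psi g * word_val Y (u g x).
  by rewrite /u; case: cid2.
(* W lifts psi to K: if K satisfies the short relations of H, then W satisfies
   those of G, hence all of them, so that loops of G lift to loops of K. *)
pose W x : wreath K G := (fun g => word_val Z (u g x), X x).
have W2 s : (word_val W s).2 = word_val X s.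
  elim: s => [|[x b] s IHs]; first by rewrite !word_val_nil.
  by rewrite !word_val_cons -IHs; case: b.
(* [t] labels the path in [H] that [psi] makes of the path [s] from [g]; the wreath coordinate at
   [g] is the value of [t] in [K]. *)
have W1 s g : exists2 t, (size t <= k * size s)%N &
    (word_val W s).1 g = word_val Z t /\ psi (g * word_val X s) = psi g * word_val Y t.
  elim: s g => [|[x b] s IHs] g.
    by exists [::] => //; rewrite !word_val_nil !mulg1.
  have [t0 t0_size [t0Z t0Y]] : exists2 t, (size t <= k)%N &
      (letter_val W (x, b)).1 g = word_val Z t /\
      psi (g * letter_val X (x, b)) = psi g * word_val Y t.
    case: b; last by exists (u g x) => //; split; last exact: u_val.
    (* An inverse letter runs backwards along the edge that starts at [g * (X x)^-1]. *)
    exists (rev (map (@inv_letter T) (u (g * (X x)^-1) x))).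
      by rewrite size_rev size_map.
    rewrite !word_val_inv; split=> //.
    by have := u_val (g * (X x)^-1) x; rewrite mulgVK => ->; rewrite mulgK.
  have [t t_size [tZ tY]] := IHs (g * letter_val X (x, b)).
  exists (t0 ++ t); first by rewrite size_cat /= mulnS leq_add.
  rewrite !word_val_cons !word_val_cat -tZ -t0Z mulgA tY t0Y mulgA; split=> //.
  by case: b {t0Z t0Y tZ tY}.
have W_rel s : word_val X s = 1 -> word_val W s = 1.
  apply: Xr => {}s s_size sX; rewrite [word_val W s]surjective_pairing W2 sX.
  congr pair; apply/funext => g; have [t t_size [-> tY]] := W1 s g.
  apply: Zr; first by rewrite /retract_bound; nia.
  by apply: (@mulgI _ (psi g)); rewrite -tY sX !mulg1.
pose p h := s2val (cid2 (psi_phi h)).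
have p_size h : (size (p h) <= k)%N by rewrite /p; case: cid2.
have p_val h : psi (phi h) = h * word_val Y (p h) by rewrite /p; case: cid2.
(* Induction along [w]: each edge forms with its image under [psi \o phi] a short loop, which is
   therefore trivial in [K]. *)
have lift w h : exists2 s, phi (h * word_val Y w) = phi h * word_val X s &
    word_val Z w * word_val Z (p (h * word_val Y w)) =
    word_val Z (p h) * (word_val W s).1 (phi h).
  elim: w h => [|a w IHw] h.
    by exists [::]; rewrite !word_val_nil ?mul1g !mulg1.
  have [s0 s0_size s0X] := phi_lip h a.
  have [s sX sZ] := IHw (h * letter_val Y a).
  exists (s0 ++ s); first by rewrite word_val_cons mulgA sX s0X word_val_cat mulgA.
  rewrite !word_val_cons word_val_cat mulgA -[LHS]mulgA sZ /= W2 -s0X !mulgA.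
  congr (_ * _).
  have [t t_size [-> tY]] := W1 s0 (phi h).
  pose ha := h * letter_val Y a.
  have /Zr : (size ((a :: p ha) ++ rev (map (@inv_letter T) (p h ++ t)))
               <= retract_bound r)%N.
    rewrite size_cat size_rev size_map size_cat /retract_bound /=.
    by move: (p_size ha) (p_size h) => *; nia.
  rewrite !word_val_cat !word_val_inv !word_val_cat !word_val_cons.
  move=> loop; apply/divg1_eq/loop/eqP; rewrite divg_eq1; apply/eqP/(@mulgI _ h).
  by rewrite !mulgA -p_val s0X tY p_val.
move=> w Yw; have [s] := lift w 1; rewrite Yw !mulg1.
rewrite -[X in X = _]mulg1 => /mulgI/esym/W_rel -> /=.
by rewrite mulg1 -[RHS]mul1g => /mulIg.
Qed.

End CoarseRetract.

(** * Agreement on short words and coarse retracts of marked groups *)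

Section MarkedSpace.
Variable n : nat.
Implicit Types (N M : marked_space n) (s t u : seq (letter 'I_n)) (k l r : nat).

Definition ev N s : quotient_group N := word_val (mg_gen (quotient_marked N)) s.

Lemma ev_class N s : ev N s = quot_class N (word_val (@fg_gen 'I_n) s).
Proof. by rewrite morph_word_val. Qed.

Lemma ev_cat N s t : ev N (s ++ t) = ev N s * ev N t.
Proof. exact: word_val_cat. Qed.

Lemma set_val_ev N (w : free_group 'I_n) : set_val N w = (ev N w == 1).
Proof.
by rewrite ev_class -/(fg_eval _ _) fg_eval_id quot_class_eq1.
Qed.

Lemma ev_eq1 N s : (ev N s == 1) = set_val N (word_val (@fg_gen 'I_n) s).
Proof. by rewrite ev_class quot_class_eq1. Qed.

(** These sets of [M] turn out to form a neighbourhood basis at [N]. *)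
Definition agree l N M := forall s, (size s <= l)%N -> (ev N s == 1) = (ev M s == 1).

Lemma agree_sym l N M : agree l N M -> agree l M N.
Proof. by move=> NM s sl; rewrite NM. Qed.

Lemma agree_trans l M N P : agree l N M -> agree l M P -> agree l N P.
Proof. by move=> NM MP s sl; rewrite NM // MP. Qed.

Lemma agree_le l l' N M : (l <= l')%N -> agree l' N M -> agree l N M.
Proof. by move=> ll' NM s sl; rewrite NM // (leq_trans sl). Qed.

Lemma ev_inj N M : (forall s, (ev N s == 1) = (ev M s == 1)) -> N = M.
Proof.
by move=> NM; apply/val_inj/funext => w; have := NM w; rewrite -!set_val_ev.
Qed.

Lemma agree_eq N M l s t : agree l N M -> (size s + size t <= l)%N ->
  ev N s = ev N t -> ev M s = ev M t.
Proof.
move=> NM stl E.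
have := NM (s ++ rev (map (@inv_letter _) t)).
rewrite size_cat size_rev size_map !ev_cat [ev N (rev _)]word_val_inv.
rewrite [ev M (rev _)]word_val_inv !divg_eq1 E eqxx => /(_ stl)/esym/eqP.
by [].
Qed.

(** Distance at most [k] in the Cayley graph, stated on words rather than elements: coarse maps then
    live on one set independent of [N], and limits of them make sense. *)
Definition near N k s t := exists2 u, (size u <= k)%N & ev N t = ev N s * ev N u.

Lemma near_trans N k l t s u :
  near N k s t -> near N l t u -> near N (k + l) s u.
Proof.
move=> [w wk wE] [v vl vE]; exists (w ++ v); first by rewrite size_cat leq_add.
by rewrite ev_cat vE wE mulgA.
Qed.

Lemma near_le N k l s t : (k <= l)%N -> near N k s t -> near N l s t.
Proof. by move=> kl [u uk uE]; exists u => //; exact: leq_trans kl. Qed.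

Lemma near_agree N M k l s t : agree l N M -> (size s + size t + k <= l)%N ->
  near N k s t -> near M k s t.
Proof.
move=> NM l_ge [u uk uE]; exists u => //; rewrite -ev_cat.
apply: (agree_eq NM); last by rewrite ev_cat.
by rewrite size_cat; lia.
Qed.

(* The bounds on the sizes of [phi s] and [psi s] only serve to make the set of
   related pairs closed, cf. [coarse_retract_closed]. *)
Definition coarse_retract k N M := exists phi psi : seq (letter 'I_n) -> seq (letter 'I_n),
  [/\ forall s, (size (phi s) <= k * size s + k)%N /\ (size (psi s) <= k * size s + k)%N,
      forall s t, near N 1 s t -> near M k (phi s) (phi t),
      forall s t, near M 1 s t -> near N k (psi s) (psi t)
    & forall s, near N k s (psi (phi s))].

Lemma coarse_retract_le k l N M :
  (k <= l)%N -> coarse_retract k N M -> coarse_retract l N M.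
Proof.
move=> kl [phi [psi [sz phiL psiL psi_phi]]]; exists phi, psi; split.
- move=> s; have [phis psis] := sz s.
  by split; [apply: leq_trans phis _|apply: leq_trans psis _]; rewrite leq_add ?leq_mul.
- by move=> s t /phiL; exact: near_le.
- by move=> s t /psiL; exact: near_le.
- by move=> s; exact: near_le (psi_phi s).
Qed.

Definition marked_bound N r := relator_bound (mg_gen (quotient_marked N)) r.

Lemma marked_bound_sub N M r : marked_bound N r -> agree r N M ->
  forall s, ev N s = 1 -> ev M s = 1.
Proof. by move=> Nr NM; apply: Nr => s sr /eqP; rewrite NM // => /eqP. Qed.

Lemma marked_bound_eq N M r : marked_bound N r -> marked_bound M r ->
  agree r N M -> N = M.
Proof.
move=> Nr Mr NM; apply: ev_inj => s; apply/eqP/eqP.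
  exact: marked_bound_sub Nr NM s.
exact: marked_bound_sub Mr (agree_sym NM) s.
Qed.

Lemma marked_bound_le N r r' : (r <= r')%N -> marked_bound N r -> marked_bound N r'.
Proof.
move=> rr' Nr K Z H; apply: Nr => s sr; apply: H; exact: leq_trans rr'.
Qed.

(** Maps on words become maps on groups by choosing a geodesic word for each element. The second [k]
    pays for replacing [phi (wN h)] by the chosen word of the same element before applying [psi]. *)
Lemma marked_bound_retract k N M r : coarse_retract k N M -> marked_bound M r ->
  marked_bound N (retract_bound (k + k) r).
Proof.
move=> [phi [psi [_ phiL psiL psi_phi]]].
pose wN (h : quotient_marked N) := s2val (cid2 (word_lengthP h)).
pose wM (g : quotient_marked M) := s2val (cid2 (word_lengthP g)).
have wNK h : ev N (wN h) = h by rewrite /wN; case: cid2.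
have wMK g : ev M (wM g) = g by rewrite /wM; case: cid2.
apply: (@relator_bound_retract _ _ (quotient_marked M) (quotient_marked N)
  _ _ (ev M \o phi \o wN) (ev N \o psi \o wM)).
- move=> h a.
  have /phiL : near N 1 (wN h) (wN (h * letter_val (mg_gen (quotient_marked N)) a)).
    by exists [:: a] => //; rewrite !wNK [ev N [:: a]]word_val_cons word_val_nil mulg1.
  by case=> s sk sE; exists s => //; apply: leq_trans sk _; exact: leq_addr.
- move=> g x; have /psiL : near M 1 (wM g) (wM (g * mg_gen (quotient_marked M) x)).
    exists [:: (x, false)] => //.
    by rewrite !wMK [ev M [:: _]]word_val_cons word_val_nil mulg1.
  by case=> s sk sE; exists s => //; apply: leq_trans sk _; exact: leq_addr.
- move=> h; have /psiL E : near M 1 (phi (wN h)) (wM (ev M (phi (wN h)))).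
    by exists [::] => //; rewrite wMK [ev M [::]]word_val_nil mulg1.
  have [t tk tE] := near_trans (psi_phi (wN h)) E.
  by exists t => //=; rewrite tE wNK.
Qed.

End MarkedSpace.

(** Finite presentability concerns some generating tuple. [f] and [g] make [M] a coarse retract of
    [G], with [k] bounding the words that write each set of generators in the other. *)
Lemma relator_bound_isom n (M : marked_group n) (G : groupType) (f : M -> G) (g : G -> M) :
    {morph f : x y / x * y} -> {morph g : x y / x * y} -> cancel f g ->
    finitely_presented G ->
  exists r, relator_bound (mg_gen M) r.
Proof.
move=> fM gM fK [m [X [R [Xgen E]]]].
have [r Xr] := relator_bound_presented E.
pose wX (x : G) := sval (cid (Xgen x)).
have wXK x : word_val X (wX x) = x by rewrite /wX; case: cid.
pose wM (x : M) := sval (cid (mg_generates x)).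
have wMK x : word_val (mg_gen M) (wM x) = x by rewrite /wM; case: cid.
pose k := maxn (\max_(a : letter 'I_n) size (wX (f (letter_val (mg_gen M) a))))
               (\max_(i < m) size (wM (g (X i)))).
exists (retract_bound k r).
apply: (@relator_bound_retract _ _ G M X _ f g k _ _ _ _ Xr).
- move=> h a; exists (wX (f (letter_val (mg_gen M) a))); last by rewrite fM wXK.
  by rewrite leq_max (leq_bigmax (F := fun a => size (wX (f (letter_val (mg_gen M) a))))).
- move=> h i; exists (wM (g (X i))); last by rewrite gM wMK.
  by rewrite leq_max (leq_bigmax (F := fun i => size (wM (g (X i))))) orbT.
- by move=> h; exists [::]; rewrite // word_val_nil mulg1.
Qed.

(** * Limits of coarse retracts *)

Lemma finite_words (T : finType) l :
  exists ws : seq (seq T), forall s, (size s <= l)%N -> s \in ws.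
Proof.
elim: l => [|l [ws wsP]].
  by exists [:: [::]] => s; rewrite leqn0 => /nilP ->; rewrite inE.
exists ([::] :: [seq a :: s | a <- enum T, s <- ws]) => -[|a s] //= sl.
by rewrite inE; apply/orP; right; apply/allpairsP; exists (a, s); rewrite mem_enum wsP.
Qed.

Lemma ultra_finite (S : Type) (F : set_system S) (FF : UltraFilter F) (T : eqType)
    (f : S -> T) (vs : seq T) :
  F [set x | f x \in vs] -> exists v, F [set x | f x = v].
Proof.
elim: vs => [|v vs IH] Fvs.
  by case: (@filter_not_empty _ F _); apply: filterS Fvs.
have [Fv|Fv] := in_ultra_setVsetC [set x | f x = v] FF; first by exists v.
apply: IH; apply: filterS2 Fvs Fv => x /=.
by rewrite inE => /orP[/eqP|].
Qed.

(** The size bounds leave finitely many values for [phi i s] and [psi i s], so both sequences of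
    maps converge pointwise along a free ultrafilter. Each condition on the limits involves few
    words and is inherited from one large index. *)
Lemma coarse_retract_closed n k (N M : marked_space n) (u v : nat -> marked_space n) :
    (forall l, agree l N (u l)) -> (forall l, agree l M (v l)) ->
    (forall l, coarse_retract k (u l) (v l)) ->
  coarse_retract k N M.
Proof.
move=> Nu Mv /choice[phi] /(@choice nat)[psi] ret.
have [F [FU le_oo]] := ultraFilterLemma eventually_filter.
have F_ge l : F [set i | (l <= i)%N] by apply: le_oo; exists l.
have limit (f : nat -> seq (letter 'I_n) -> seq (letter 'I_n)) :
    (forall i s, (size (f i s) <= k * size s + k)%N) ->
    exists g, forall s, F [set i | f i s = g s].
  move=> fs; suff /choice[g gF] : forall s, exists t, F [set i | f i s = t] by exists g.
  move=> s.
  have [ws wsP] := finite_words (letter 'I_n) (k * size s + k).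
  by apply: (@ultra_finite _ _ _ _ (f ^~ s) ws); apply: filterE => i; exact: wsP.
have [|phi' phiF] := limit phi; first by move=> i s; have [/(_ s)[]] := ret i.
have [|psi' psiF] := limit psi; first by move=> i s; have [/(_ s)[]] := ret i.
exists phi', psi'; split.
- move=> s; have [i /= [<- <-]] := @filter_ex _ F _ _ (filterI (phiF s) (psiF s)).
  by have [+ _ _ _] := ret i; apply.
(* [l] covers both transfers: the hypothesis from [N] to [u i] and the conclusion from [v i] back to
   [M]. *)
- move=> s t st; pose l := (size s + size t + 1 + (size (phi' s) + size (phi' t) + k))%N.
  have [i /= [[is_ it] li]] :=
    @filter_ex _ F _ _ (filterI (filterI (phiF s) (phiF t)) (F_ge l)).
  have [_ phiL _ _] := ret i.
  apply: (near_agree (agree_sym (Mv i))); first by apply: leq_trans li; rewrite /l; lia.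
  rewrite -is_ -it; apply: phiL; apply: (near_agree (Nu i)) st.
  by apply: leq_trans li; rewrite /l; lia.
- move=> s t st; pose l := (size s + size t + 1 + (size (psi' s) + size (psi' t) + k))%N.
  have [i /= [[is_ it] li]] :=
    @filter_ex _ F _ _ (filterI (filterI (psiF s) (psiF t)) (F_ge l)).
  have [_ _ psiL _] := ret i.
  apply: (near_agree (agree_sym (Nu i))); first by apply: leq_trans li; rewrite /l; lia.
  rewrite -is_ -it; apply: psiL; apply: (near_agree (Mv i)) st.
  by apply: leq_trans li; rewrite /l; lia.
- move=> s; pose l := (size s + size (psi' (phi' s)) + k)%N.
  have [i /= [[is_ it] li]] :=
    @filter_ex _ F _ _ (filterI (filterI (phiF s) (psiF (phi' s))) (F_ge l)).
  have [_ _ _ psi_phi] := ret i.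
  apply: (near_agree (agree_sym (Nu i)) li).
  by rewrite -it -is_.
Qed.

(** * From quasi-isometries to coarse retracts *)

Lemma nearP n (N : marked_space n) k s t :
  near N k s t <-> (word_length ((ev N s)^-1 * ev N t : quotient_marked N) <= k)%N.
Proof.
split=> [[u uk ->]|st]; first by rewrite mulKg (leq_trans (word_length_le _ _)).
have [u u_size uE] := word_lengthP ((ev N s)^-1 * ev N t : quotient_marked N).
by exists u; rewrite ?u_size // [ev N u]uE mulVKg.
Qed.

Section QuasiIsometry.
Import Order.POrderTheory GRing.Theory Num.Theory.

Lemma coarse_retract_quasi_isometric (R : realType) n (N M : marked_space n) :
    quasi_isometric (word_space R (quotient_marked N))
                    (word_space R (quotient_marked M)) ->
  exists k, coarse_retract k N M.
Proof.
pose G := quotient_marked N; pose H := quotient_marked M.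
move=> [C [phi0 [psi0 [phiL0 psiL0 _ psi_phi0]]]].
pose phi : G -> H := phi0; pose psi : H -> G := psi0.
have phiL x y : ((word_length ((phi x)^-1 * phi y))%:R <=
    C * (word_length (x^-1 * y))%:R + C)%R := phiL0 x y.
have psiL x y : ((word_length ((psi x)^-1 * psi y))%:R <=
    C * (word_length (x^-1 * y))%:R + C)%R := psiL0 x y.
have psi_phi x : ((word_length ((psi (phi x))^-1 * x))%:R <= C)%R := psi_phi0 x.
have C0 : (0 <= C)%R by apply: le_trans (psi_phi 1); exact: ler0n.
(* One [C] is the additive constant, the other the displacement of 1 under [psi \o phi]. *)
have [k kC] : exists k : nat, (C + C <= k%:R)%R.
  by exists (Num.bound (C + C)); rewrite ltW // archi_boundP // addr_ge0.
have bound a b : (b%:R <= C * a%:R + (C + C))%R -> (b <= k * a + k)%N.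
  move=> ab; rewrite -(ler_nat R) natrD natrM (le_trans ab) // lerD //.
  by rewrite ler_wpM2r ?ler0n // (le_trans _ kC) // lerDl.
have bound1 a b : (a <= 1)%N -> (b%:R <= C * a%:R + C)%R -> (b <= k)%N.
  move=> a1 ab; rewrite -(ler_nat R) (le_trans ab) // (le_trans _ kC) // lerD //.
  by rewrite -[leRHS]mulr1 ler_wpM2l // (ler_nat R a 1).
pose wN (g : G) := s2val (cid2 (word_lengthP g)).
pose wM (g : H) := s2val (cid2 (word_lengthP g)).
have wN_size g : size (wN g) = word_length g by rewrite /wN; case: cid2.
have wM_size g : size (wM g) = word_length g by rewrite /wM; case: cid2.
have wNK h : ev N (wN h) = h by rewrite /wN; case: cid2.
have wMK h : ev M (wM h) = h by rewrite /wM; case: cid2.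
(* Translating by [o] makes the first map send 1 to 1, whence the linear bound on sizes; the second
   map undoes the translation. *)
pose o : H := phi 1.
exists k, (fun s => wM (o^-1 * phi (ev N s))), (fun s => wN (psi (o * ev M s))); split.
- move=> s; rewrite wN_size wM_size; split; apply: bound.
    apply: le_trans (phiL 1 (ev N s)) _; rewrite lerD // ?lerDl //.
    by rewrite ler_wpM2l // invg1 mul1g ler_nat; exact: word_length_le.
  have := word_lengthM (psi o) ((psi o)^-1 * psi (o * ev M s)).
  rewrite mulVKg -(ler_nat R) natrD => /le_trans; apply.
  rewrite addrCA lerD //.
    by rewrite -word_lengthV -[_^-1]mulg1; exact: psi_phi.
  apply: le_trans (psiL _ _) _; rewrite lerD // ler_wpM2l //.
  by rewrite mulKg ler_nat; exact: word_length_le.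
- move=> s t /nearP st; apply/nearP; rewrite !wMK invgM invgK -mulgA mulVKg.
  exact: bound1 st (phiL _ _).
- move=> s t /nearP st; apply/nearP; rewrite !wNK; apply: bound1 (psiL _ _).
  by rewrite invgM -mulgA mulKg.
- move=> s; apply/nearP; rewrite wNK wMK mulVKg -word_lengthV invgM invgK.
  apply: (@bound1 0%N) => //; rewrite mulr0 add0r; exact: psi_phi.
Qed.

End QuasiIsometry.

(** * The topology in terms of agreement on short words *)

Section AgreeTopology.
Variable n : nat.
Implicit Types (N M : marked_space n).

Lemma nbhs_agree N l : nbhs N (agree l N).
Proof.
have [ws wsP] := finite_words (letter 'I_n) l.
suff : nbhs N [set M | forall s, s \in ws -> (ev N s == 1) = (ev M s == 1)].
  by apply: filterS => M NM s /wsP; exact: NM.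
elim: ws {wsP} => [|s ws IH]; first exact: filterE.
have := @marked_mem_continuous n (word_val (@fg_gen _) s) N _ (discrete_set1 _).
move=> cts; apply: (@filterS2 _ (nbhs N) _ _ _ _ _ cts IH) => M /= Ms Mws t.
by rewrite inE => /orP[/eqP ->|/Mws //]; rewrite !ev_eq1 -Ms.
Qed.

(** Otherwise points outside [U] that agree with [N] on ever longer words would converge to [N]
    pointwise. *)
Lemma open_agree N (U : set (marked_space n)) :
  open U -> U N -> exists l, agree l N `<=` U.
Proof.
move=> oU UN; apply: contrapT => noU.
have /choice[u uP] : forall l, exists M, agree l N M /\ ~ U M.
  move=> l; apply: contrapT => H; apply: noU; exists l => M NM.
  by apply: contrapT => UM; apply: H; exists M.
have cvg_u : (fun l => set_val (u l) : {ptws free_group 'I_n -> bool}) @ \oo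
    --> (set_val N : {ptws free_group 'I_n -> bool}).
  apply/cvg_sup => w V.
  case=> _ [[/= W oW <-] /= WN] /filterS; apply.
  exists (size w) => // l wl; apply: (@eq_ind_r _ (set_val N w) W WN).
  by rewrite !set_val_ev; have [/(_ w wl)<-] := uP l.
case: oU => V oV VU.
have /cvg_u [l _ /(_ l (leqnn l))] : nbhs (set_val N : {ptws free_group 'I_n -> bool}) V.
  by apply: open_nbhs_nbhs; split=> //; move: UN; rewrite -VU.
by have [_] := uP l; rewrite -VU.
Qed.

End AgreeTopology.

Lemma open_marked_incl n (U : set (marked_space n.+1)) :
  open U -> open (@marked_incl n @` U).
Proof.
(* [V m] is [U] for [m = n] and empty otherwise, written without transport along [m = n]. *)
move=> oU; pose V m := [set M : marked_space m.+1 |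
  m = n /\ (@marked_incl n @` U) (marked_incl M)].
exists V => [m|].
  have [mn|mn] := eqVneq m n; last first.
    rewrite (_ : V m = set0) ?seteqP; first exact: open0.
    by split=> // M [/eqP]; rewrite (negbTE mn).
  subst m; rewrite (_ : V n = U) //; apply/seteqP; split=> M.
    by case=> _ [M' UM' /marked_incl_inj <-].
  by move=> UM; split=> //; exists M.
apply/seteqP; split=> p.
  by case=> M UM <-; exists n => //; exists M => //; split=> //; exists M.
by case=> m _ [M [_ UM] <-].
Qed.

(** * Points of [P] with a fixed number of generators *)

Section Trace.
Variables (P : set marked_groups) (n : nat).
Implicit Types N M : marked_space n.+1.

Definition trace : set (marked_space n.+1) := @marked_incl n @^-1` P.

Lemma trace_closed N : closed P ->
  (forall l, exists2 M, trace M & agree l N M) -> trace N.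
Proof.
move=> /closed_openC /marked_openP/(_ n) oP NP; apply: contrapT => PN.
have [l NlP] := open_agree oP PN.
have [M PM NM] := NP l; exact: NlP PM.
Qed.

(** The image of a neighbourhood at level [n] is open in the union, so nearby points of [P] can be
    found with the same number of generators. *)
Lemma trace_perfect N l : perfect_set P -> trace N ->
  exists M, [/\ trace M, agree l N M & M != N].
Proof.
move=> [_ Plim] PN; have : limit_point P (marked_incl N) by rewrite Plim.
move=> /(_ (@marked_incl n @` (agree l N)°)) [].
  apply: open_nbhs_nbhs; split; first exact/open_marked_incl/open_interior.
  by exists N => //; exact: nbhs_agree.
move=> p [pN Pp [M /interior_subset NM ME]]; exists M; split=> //.
  by rewrite /trace /= ME.
by apply: contra pN => /eqP <-; rewrite ME.
Qed.

Lemma trace_dense (D : set (set_type P)) N l : dense D -> trace N ->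
  exists M q, [/\ trace M, agree l N M, D q & set_val q = marked_incl M].
Proof.
move=> dD PN.
pose O : set (set_type P) := set_val @^-1` (@marked_incl n @` (agree l N)°).
have [||q [[M /interior_subset NM ME] Dq]] := dD O.
- exists (exist _ (marked_incl N) (mem_set PN)).
  by exists N => //; exact: nbhs_agree.
- by exists (@marked_incl n @` (agree l N)°) => //; exact/open_marked_incl/open_interior.
- exists M, q; split=> //; rewrite /trace /= ME; exact: set_valP.
Qed.

Lemma trace_dense_interior (F : set (set_type P)) N l : dense F° -> trace N ->
  exists M, [/\ trace M, agree l N M & exists l',
    forall M' (PM' : trace M'), agree l' M M' -> F (exist _ (marked_incl M') (mem_set PM'))].
Proof.
move=> dF PN; have [M [q [PM NM Fq qM]]] := trace_dense l dF PN.
exists M; split=> //.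
have [V oV VF] := open_interior F.
have /marked_openP/(_ n) oVn : marked_open V := oV.
have [|l' MV] := @open_agree _ M _ oVn; first by rewrite /= -qM; move: Fq; rewrite -VF.
exists l' => M' PM' /MV VM'; apply: (@interior_subset _ F).
by rewrite -VF.
Qed.

End Trace.

(** * Independence of the chosen number of generators *)

(** As [N] is the preimage of [M], [change_gens] descends to an injective map; generators go to
    generators or to 1, so lengths do not grow. *)
Lemma change_gens_class m n (M : marked_space m) (N : marked_space n) :
    (forall w, set_val N w = set_val M (change_gens m w)) ->
  exists f : quotient_group N -> quotient_group M,
    [/\ forall w, f (quot_class N w) = quot_class M (change_gens m w),
        {morph f : x y / x * y}, injective f
      & forall g, (word_length (f g : quotient_marked M)
          <= word_length (g : quotient_marked N))%N].
Proof.
move=> NM; pose f (a : quotient_group N) := quot_class M (change_gens m (repr a)).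
have fE w : f (quot_class N w) = quot_class M (change_gens m w).
  apply/quot_classP; rewrite -gmulfV -gmulfM -NM; exact: repr_quot_class.
exists f; split=> // [x y|x y|g].
- have [[x' ->] [y' ->]] := (quot_class_surj x, quot_class_surj y).
  by rewrite -gmulfM !fE -gmulfM -gmulfM.
- have [[x' ->] [y' ->]] := (quot_class_surj x, quot_class_surj y).
  rewrite !fE => /quot_classP; rewrite -gmulfV -gmulfM -NM => xy.
  exact/quot_classP.
have [s <- <-] := word_lengthP (g : quotient_marked N).
rewrite -[word_val _ s]/(ev N s) ev_class fE /change_gens word_val_reduced morph_word_val.
have gen_len (j : 'I_m) :
    (word_length (quot_class M (fg_gen j) : quotient_marked M) <= 1)%N.
  have := word_length_le (quotient_marked M) [:: (j, false)].
  by rewrite word_val_cons word_val_nil mulg1.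
elim: s => [|a s IHs]; first by rewrite word_val_nil word_length1.
rewrite word_val_cons (leq_trans (word_lengthM _ _)) //= -add1n leq_add //.
rewrite /letter_val; case: a => i [] /=; rewrite ?word_lengthV; case: insubP => [j _ _|_].
- exact: gen_len.
- by rewrite gmulf1 word_length1.
- exact: gen_len.
- by rewrite gmulf1 word_length1.
Qed.

(** The maps induced in both directions do not increase length. One composite is the identity
    because it passes through the larger number of generators; injectivity gives the other. *)
Lemma marked_incl_isometry m n (M : marked_space m.+1) (N : marked_space n.+1) :
    marked_incl M = marked_incl N ->
  exists (f : quotient_marked N -> quotient_marked M)
         (g : quotient_marked M -> quotient_marked N),
    [/\ {morph f : x y / x * y}, {morph g : x y / x * y}, cancel f g, cancel g f
      & forall x, word_length (f x) = word_length x].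
Proof.
move=> MN; have [ME NE] := (marked_incl_eqP M N).1 MN.
have [NE' ME'] := (marked_incl_eqP N M).1 (esym MN).
have [f [fE fM f_inj f_len]] :=
  @change_gens_class _ _ M N (fun w => congr1 (fun N => set_val N w) NE').
have [g [gE gM g_inj g_len]] :=
  @change_gens_class _ _ N M (fun w => congr1 (fun N => set_val N w) ME).
have [fK gK] : cancel f g /\ cancel g f.
  have [mn|/ltnW nm] := leqP m n.
    suff gK : cancel g f by split=> // x; apply: f_inj; rewrite gK.
    move=> x; have [w ->] := quot_class_surj x.
    by rewrite gE fE change_gens_comp ?ltnS ?mn // change_gens_id.
  suff fK : cancel f g by split=> // x; apply: g_inj; rewrite fK.
  move=> x; have [w ->] := quot_class_surj x.
  by rewrite fE gE change_gens_comp ?ltnS ?nm // change_gens_id.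
exists f, g; split=> // x; apply/eqP; rewrite eqn_leq f_len /=.
by rewrite -{1}(fK x) g_len.
Qed.

Lemma marked_incl_of (p : marked_groups) : marked_incl (tagged (repr p)) = p.
Proof. by rewrite /marked_incl -[RHS]reprK; case: (repr p). Qed.

Lemma quasi_isometric_isometry (R : realType) (S S' T T' : metricType R)
    (f : S -> S') (f' : S' -> S) (g : T -> T') (g' : T' -> T) :
    cancel f f' -> cancel f' f -> cancel g g' -> cancel g' g ->
    (forall x y, mdist (f x) (f y) = mdist x y) ->
    (forall x y, mdist (g x) (g y) = mdist x y) ->
  quasi_isometric S' T' -> quasi_isometric S T.
Proof.
move=> fK f'K gK g'K fi gi [C [phi [psi [phiL psiL phi_psi psi_phi]]]].
exists C, (g' \o phi \o f), (f' \o psi \o g); split=> /= [x y|x y|t|s].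
- by rewrite -gi !g'K -[X in (_ <= _ * X + _)%R]fi.
- by rewrite -fi !f'K -[X in (_ <= _ * X + _)%R]gi.
- by rewrite f'K -gi g'K.
- by rewrite g'K -fi f'K.
Qed.

Lemma coarse_retract_qi_class (R : realType) n (N M : marked_space n.+1) :
  qi_class R (marked_incl N) (marked_incl M) -> exists k, coarse_retract k N M.
Proof.
move=> NM; apply: (@coarse_retract_quasi_isometric R).
have [f [f' [fM _ fK f'K f_len]]] := marked_incl_isometry (marked_incl_of (marked_incl N)).
have [g [g' [gM _ gK g'K g_len]]] := marked_incl_isometry (marked_incl_of (marked_incl M)).
have isom m l (X : marked_group m) (Y : marked_group l) (h : X -> Y) :
    {morph h : x y / x * y} -> (forall x, word_length (h x) = word_length x) ->
    forall x y, word_length ((h x)^-1 * h y) = word_length (x^-1 * y).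
  move=> hM h_len x y; rewrite -[RHS]h_len; congr word_length.
  by apply: (@mulgI _ (h x)); rewrite mulVKg -hM mulVKg.
apply: (@quasi_isometric_isometry R
  (word_space R (quotient_marked N)) (word_space R (marked_group_of (marked_incl N)))
  (word_space R (quotient_marked M)) (word_space R (marked_group_of (marked_incl M)))
  f f' g g' fK f'K gK g'K) NM => x y.
  by congr (_%:R%R); exact: isom.
by congr (_%:R%R); exact: isom.
Qed.

Lemma marked_bound_presented n (N : marked_space n.+1) :
  finitely_presented (marked_group_of (marked_incl N)) -> exists r, marked_bound N r.
Proof.
have [f [g [fM gM fK _ _]]] := marked_incl_isometry (marked_incl_of (marked_incl N)).
exact: (@relator_bound_isom _ (quotient_marked N) _ f g).
Qed.

(** * Density of the pairs that are not coarse retracts *)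

Lemma not_coarse_retract_dense (P : set marked_groups) n (D : set (set_type P)) k l
    (N1 N2 : marked_space n.+1) :
    perfect_set P -> dense D ->
    (forall p, D p -> finitely_presented (marked_group_of (set_val p))) ->
    trace P N1 -> trace P N2 ->
  exists M1 M2 l', [/\ trace P M1 /\ trace P M2, agree l N1 M1, agree l N2 M2
    & forall M1' M2', agree l' M1 M1' -> agree l' M2 M2' -> ~ coarse_retract k M1' M2'].
Proof.
move=> perfP dD Dfp PN1 PN2.
have fp_dense (N : marked_space n.+1) : trace P N ->
    exists M r, [/\ trace P M, agree l N M & marked_bound M r].
  move=> PN; have [M [q [PM NM Dq qM]]] := trace_dense l dD PN.
  have [|r Mr] := @marked_bound_presented _ M; last by exists M, r.
  by rewrite -qM; exact: Dfp.
have [M1 [r1 [PM1 NM1 Mr1]]] := fp_dense _ PN1.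
have [M2 [r2 [PM2 NM2 Mr2]]] := fp_dense _ PN2.
(* A [k]-retract of [M2] has relator bound [r]; one that agrees with [M1] up to [L] must equal
   [M1]. *)
pose r := retract_bound (k + k) r2; pose L := maxn l (maxn r1 r).
have [lL r1L rL] : [/\ l <= L, r1 <= L & r <= L]%N by rewrite /L; split; lia.
have [M [PM M1M MneM1]] := trace_perfect L perfP PM1.
have nret : ~ coarse_retract k M M2.
  move=> /marked_bound_retract/(_ Mr2) Mr; apply/negP: MneM1; rewrite negbK.
  apply/eqP/esym/(marked_bound_eq (marked_bound_le r1L Mr1) _ M1M).
  exact: marked_bound_le Mr.
(* If no ball around [(M, M2)] avoided the relation, related pairs would converge to it, and the
   relation is closed. *)
apply: contrapT => H; apply: nret.
have /choice[u uP] : forall l', exists X : marked_space n.+1 * marked_space n.+1,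
    [/\ agree l' M X.1, agree l' M2 X.2 & coarse_retract k X.1 X.2].
  move=> l'; apply: contrapT => H'; apply: H; exists M, M2, l'; split=> //.
    exact: agree_trans NM1 (agree_le lL M1M).
  by move=> M1' M2' ? ? ret; apply: H'; exists (M1', M2').
by apply: (@coarse_retract_closed _ k M M2 (fst \o u) (snd \o u)) => l' /=; case: (uP l').
Qed.

(** * The Cantor scheme *)

(** Requirements survive refinement, so finitely many can be met one after another. *)
Lemma refine_all (S : Type) (J : eqType) (ok : S -> Prop) (le : S -> S -> Prop)
    (req : J -> S -> Prop) (js : seq J) :
    (forall x, le x x) -> (forall y x z, le x y -> le y z -> le x z) ->
    (forall j x y, le x y -> req j y -> req j x) ->
    (forall j x, ok x -> exists y, [/\ ok y, le y x & req j y]) ->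
  forall x, ok x -> exists y, [/\ ok y, le y x & forall j, j \in js -> req j y].
Proof.
move=> le_refl le_trans req_le meet; elim: js => [|j js IH] x okx; first by exists x.
have [y [oky yx yj]] := meet j x okx; have [z [okz zy zjs]] := IH y oky.
exists z; split=> // [|i]; first exact: le_trans zy yx.
by rewrite inE => /orP[/eqP ->|/zjs //]; exact: req_le zy yj.
Qed.

Section Limit.
Variables (n : nat) (N : nat -> marked_space n) (l : nat -> nat).
Hypothesis l_ge : forall i, (i <= l i)%N.
Hypothesis l_mono : forall i, (l i <= l i.+1)%N.
Hypothesis N_agree : forall i, agree (l i) (N i) (N i.+1).

Let agree_ge i j : (i <= j)%N -> agree (l i) (N i) (N j).
Proof.
elim: j => [|j IH]; first by rewrite leqn0 => /eqP ->.
rewrite leq_eqVlt => /predU1P[-> //|ij]; apply: agree_trans (IH ij) _.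
apply: agree_le (@N_agree j).
exact: (@homo_leq _ l leq (@leqnn) (fun _ _ _ => @leq_trans _ _ _) l_mono).
Qed.

Lemma agree_limit : exists M, forall i, agree (l i) (N i) M.
Proof.
(* Membership of [w] is settled from stage [size w] on, since [l i] is at least [i]. *)
pose p : free_group 'I_n -> bool := fun w => set_val (N (size w)) w.
have pE (w : free_group 'I_n) j : (size w <= j)%N -> p w = set_val (N j) w.
  by move=> wj; rewrite /p !set_val_ev; apply: (agree_ge wj); exact: l_ge.
have pn : normal_subgroups (free_group 'I_n) p.
  split=> [|x y px py|x y px]; first exact: normal1.
    pose j := (size x + size y + size (x / y)%g)%N.
    move: px py; rewrite !(@pE _ j) /j; try lia; exact: normalF.
  pose j := (size x + size (x ^ y)%g)%N.
  move: px; rewrite !(@pE _ j) /j; try lia; exact: normalJ.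
exists (exist (fun N => N \in normal_subgroups (free_group 'I_n)) _ (mem_set pn)) => i s sl.
rewrite [RHS]ev_eq1 /=; set w := word_val _ s.
rewrite -[RHS]/(p w) (@pE w (maxn i (size w))) ?leq_maxr // -ev_eq1.
by apply: (agree_ge (leq_maxl _ _)).
Qed.

End Limit.

Section CantorScheme.
Variables (P : set marked_groups) (n : nat) (A : nat -> set (set_type P)).
Local Notation space := (marked_space n.+1).
Hypothesis closedP : closed P.
Hypothesis denseA : forall i, dense (A i)°.
Hypothesis not_retract_dense : forall k l (N1 N2 : space), trace P N1 -> trace P N2 ->
  exists M1 M2 l', [/\ trace P M1 /\ trace P M2, agree l N1 M1, agree l N2 M2
    & forall M1' M2', agree l' M1 M1' -> agree l' M2 M2' -> ~ coarse_retract k M1' M2'].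

(* (N, l) stands for the clopen set of the points M with agree l N M. *)
Let cell : Type := (space * nat)%type.
Let state : Type := seq bool -> cell.

Let refines (c d : cell) := agree d.2 d.1 c.1 /\ (d.2 <= c.2)%N.

Let valid (f : state) := forall s, trace P (f s).1.
Let le (f g : state) := forall s, refines (f s) (g s).

(** The clauses serve, in order, to make branches converge, to put their limits into [A i], and to
    separate distinct branches. *)
Let req i (st : seq bool * seq bool) (f : state) :=
  [/\ (i < (f st.1).2)%N,
      forall M (PM : trace P M), agree (f st.1).2 (f st.1).1 M ->
        A i (exist _ (marked_incl M) (mem_set PM))
    & st.1 != st.2 -> forall M1 M2, agree (f st.1).2 (f st.1).1 M1 ->
        agree (f st.2).2 (f st.2).1 M2 -> ~ coarse_retract i M1 M2].

Let refines_refl c : refines c c. Proof. by []. Qed.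

Let refines_trans d c e : refines c d -> refines d e -> refines c e.
Proof.
move=> [dc dcl] [ed edl]; split; last exact: leq_trans dcl.
exact: agree_trans ed (agree_le edl dc).
Qed.

Let refines_agree c d M : refines c d -> agree c.2 c.1 M -> agree d.2 d.1 M.
Proof. by move=> [dc dcl] cM; apply: agree_trans dc (agree_le dcl cM). Qed.

Let upd (f : state) s c : state := fun t => if t == s then c else f t.

Let upd_le f s c : refines c (f s) -> le (upd f s c) f.
Proof. by move=> cf t; rewrite /upd; case: eqP => [->|]. Qed.

Let upd_valid f s c : trace P c.1 -> valid f -> valid (upd f s c).
Proof. by move=> Pc Pf t; rewrite /upd; case: ifP. Qed.

Let le_req i st f g : le f g -> req i st g -> req i st f.
Proof.
case: st => s t fg [/= gs gA gsep]; split=> /= [|M PM fM|st M1 M2 fM1 fM2].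
- by have [_] := fg s; exact: leq_trans gs.
- by apply: gA; exact: refines_agree fM.
- by apply: gsep => //; [exact: refines_agree fM1|exact: refines_agree fM2].
Qed.

(** The cell at [s] is first shrunk into [A i]; if [s] and [t] differ, both cells are then shrunk
    around an unrelated pair. All other cells stay. *)
Let meet_req i st f : valid f -> exists g, [/\ valid g, le g f & req i st g].
Proof.
case: st => s t Pf.
have [M [PM fM [l MA]]] := @trace_dense_interior P n _ _ (f s).2 (@denseA i) (Pf s).
pose c : cell := (M, maxn (f s).2 (maxn i.+1 l)).
have c_f : refines c (f s) by split=> //=; rewrite leq_max leqnn.
have cA M' (PM' : trace P M') : agree c.2 c.1 M' ->
    A i (exist _ (marked_incl M') (mem_set PM')).
  by move=> cM'; apply: MA; apply: agree_le cM'; rewrite /= !leq_max leqnn !orbT.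
have [<-|st] := eqVneq s t.
  exists (upd f s c); split; [exact: upd_valid|exact: upd_le|split=> /=].
  - by rewrite /upd eqxx /=; lia.
  - by move=> M' PM'; rewrite /upd eqxx; exact: cA.
  - by rewrite eqxx.
have [M1 [M2 [l' [[PM1 PM2] cM1 fM2 sep]]]] :=
  @not_retract_dense i (maxn c.2 (f t).2) c.1 (f t).1 PM (Pf t).
pose L := maxn (maxn c.2 (f t).2) l'.
have c1c : refines (M1, L) c.
  by split=> /=; [apply: agree_le cM1; exact: leq_maxl|rewrite /L /=; lia].
have c2f : refines (M2, L) (f t).
  by split=> /=; [apply: agree_le fM2; exact: leq_maxr|rewrite /L /=; lia].
have ts : t == s = false by rewrite eq_sym (negbTE st).
exists (upd (upd f s (M1, L)) t (M2, L)); split.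
- by apply: upd_valid => //; exact: upd_valid.
- move=> r; apply: refines_trans (upd_le _ r) (upd_le _ r).
    by rewrite /upd ts.
  exact: refines_trans c1c c_f.
- rewrite /req /= /upd (negbTE st) !eqxx; split=> [|M' PM' M'M|_ M1' M2' M1M M2M].
  + by rewrite /= /L /c /=; lia.
  + by apply: cA; exact: refines_agree M'M.
  + by apply: sep; [apply: agree_le M1M|apply: agree_le M2M]; rewrite /= leq_maxr.
Qed.

Let next i (f : state) : valid f -> exists g : state,
  [/\ valid g, forall s, refines (g s) (f (take i s))
    & forall s t, size s = i.+1 -> size t = i.+1 -> req i (s, t) g].
Proof.
move=> Pf; have [ws wsP] := finite_words bool i.+1.
(* Each string starts with the cell of its prefix of length [i]; then all pairs of strings of length
   [i.+1] are treated in turn. *)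
have [|||||g [Pg gf greq]] := @refine_all state _ valid le (req i)
    [seq (s, t) | s <- ws, t <- ws] _ _ _ _ (fun s => f (take i s)).
- by move=> g s.
- by move=> g f1 f2 fg gf s; exact: refines_trans (fg s) (gf s).
- by move=> st g1 g2; exact: le_req.
- by move=> st g; exact: meet_req.
- by move=> s; exact: Pf.
exists g; split=> // s t si ti; apply: greq; apply/allpairsP; exists (s, t).
by split=> //; apply: wsP; rewrite /= ?si ?ti.
Qed.

Lemma cantor_scheme : (exists N : space, trace P N) ->
  exists x : (nat -> bool) -> space, [/\ forall a, trace P (x a),
    forall i a (Px : trace P (x a)), A i (exist _ (marked_incl (x a)) (mem_set Px))
    & forall k a b, a <> b -> ~ coarse_retract k (x a) (x b)].
Proof.
move=> [N0 PN0].
have /choice[step stepP] : forall fi : state * nat, exists g : state, valid fi.1 ->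
    [/\ valid g, forall s, refines (g s) (fi.1 (take fi.2 s))
      & forall s t, size s = fi.2.+1 -> size t = fi.2.+1 -> req fi.2 (s, t) g].
  move=> [f i]; have [Pf|nPf] := pselect (valid f); last by exists f.
  by have [g gP] := next i Pf; exists g.
pose F := fix F i := if i is j.+1 then step (F j, j) else (fun=> (N0, 0%N)) : state.
have PF i : valid (F i).
  by elim: i => [|i IH]; [move=> s; exact: PN0|have [] := stepP (F i, i) IH].
have Fref i s : refines (F i.+1 s) (F i (take i s)).
  by have [_ + _] := stepP (F i, i) (PF i); apply.
have Freq i s t : size s = i.+1 -> size t = i.+1 -> req i (s, t) (F i.+1).
  by have [_ _] := stepP (F i, i) (PF i); apply.
have Fge i a : (i <= (F i (mkseq a i)).2)%N.
  by case: i => // i; have [] := Freq i _ _ (size_mkseq a i.+1) (size_mkseq a i.+1).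
have /choice[x xP] : forall a : nat -> bool, exists M : space,
    forall i, agree (F i (mkseq a i)).2 (F i (mkseq a i)).1 M.
  move=> a; have ref i : refines (F i.+1 (mkseq a i.+1)) (F i (mkseq a i)).
    by have := Fref i (mkseq a i.+1); rewrite -map_take take_iota (minn_idPl (leqnSn i)).
  apply: (@agree_limit _ (fun i => (F i (mkseq a i)).1) (fun i => (F i (mkseq a i)).2)).
  - by move=> i; exact: Fge.
  - by move=> i; have [] := ref i.
  - by move=> i; have [] := ref i.
exists x; split=> [a|i a Px|k a b ab ret].
- apply: trace_closed closedP _ => l; exists (F l (mkseq a l)).1; first exact: PF.
  exact: agree_sym (agree_le (Fge l a) (xP a l)).
- have [_ FA _] := Freq i _ _ (size_mkseq a i.+1) (size_mkseq a i.+1).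
  exact/FA/xP.
have [j aj] : exists j, a j != b j.
  apply: contrapT => H; apply: ab; apply/funext => j; apply/eqP/negPn/negP => abj.
  by apply: H; exists j.
(* Prefixes of length [i.+1] include position [j], where the branches differ, and stage [i] excludes
   [i]-retracts, hence [k]-retracts. *)
pose i := maxn j k.
have ne : mkseq a i.+1 != mkseq b i.+1.
  apply: contra aj => /eqP/(congr1 (nth false ^~ j)).
  by rewrite !nth_mkseq ?ltnS ?leq_maxl // => ->.
have [_ _ /(_ ne)] := Freq i _ _ (size_mkseq a i.+1) (size_mkseq b i.+1).
move=> /(_ (x a) (x b) (xP a i.+1) (xP b i.+1)); apply.
by apply: coarse_retract_le ret; rewrite leq_maxr.
Qed.

End CantorScheme.

(** * Cardinality of the space of marked groups *)

Section Cardinal.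
Local Open Scope card_scope.

(** A point is coded by the words in its kernel, each tagged with the index of its level; the empty
    word is always present and reveals the tag. *)
Lemma card_marked_groups : [set: marked_groups] #<= [set: set nat].
Proof.
pose code (q : marked_sum) : set nat := [set m | exists w : free_group 'I_(tag q).+1,
  set_val (tagged q) w /\ m = pickle (tag q, [seq (val a.1, a.2) | a <- fg_word w])].
have code_inj : injective code.
  move=> [m M] [n N] E.
  have : code (existT _ m M) (pickle (m, [::] : seq (nat * bool))).
    by exists 1; split=> //; exact: normal1.
  rewrite E => -[w [_ /(pcan_inj pickleK)[mn _]]]; move: M N E {w}; rewrite /= in mn.
  subst n => M N E; congr existT; apply/val_inj/funext => w.
  have sub (X Y : marked_space m.+1) :
      code (existT _ m X) = code (existT _ m Y) -> set_val X w -> set_val Y w.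
    move=> XY Xw.
    have : code (existT _ m X) (pickle (m, [seq (val a.1, a.2) | a <- fg_word w])).
      by exists w.
    rewrite XY => -[v [Yv /(pcan_inj pickleK)[]]].
    have pair_inj : injective (fun a : letter 'I_m.+1 => (val a.1, a.2)).
      by case=> [i b] [j c] [/val_inj -> ->].
    by move=> /(inj_map pair_inj)/val_inj ->.
  by apply/idP/idP; apply: sub.
have inj : {in [set: marked_groups] &, injective (code \o repr)}.
  by move=> p q _ _ /code_inj/(can_inj reprK).
rewrite -(card_le_eql (inj_card_eq inj)); exact: subset_card_le.
Qed.

End Cardinal.

(** * Counting quasi-isometry classes *)

Lemma qi_class_refl (R : realType) (p : marked_groups) : qi_class R p p.
Proof.
exists 1%R, id, id; split=> [x y|x y|x|x]; rewrite ?mdistxx ?Num.Theory.ler01 //.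
  by rewrite GRing.mul1r Num.Theory.lerDl Num.Theory.ler01.
by rewrite GRing.mul1r Num.Theory.lerDl Num.Theory.ler01.
Qed.

Theorem corollary1p2 (R : realType) (P : set marked_groups) :
  P !=set0 -> perfect_set P ->
  (exists2 D : set (set_type P), dense D &
    forall p, D p -> finitely_presented (marked_group_of (set_val p))) ->
  qi_diverse R P.
Proof.
move=> [p0 Pp0] perfP [D dD Dfp] _ [F dF ->].
have [n [N0 p0E]] := marked_inclP p0; subst p0.
have [x [Px xF x_ret]] := @cantor_scheme P n F perfP.1 dF
  (fun k l N1 N2 => not_coarse_retract_dense k l perfP dD Dfp) (ex_intro _ N0 Pp0).
rewrite card_eq_le; apply/andP; split.
  apply: card_le_trans (card_image_le _ _) _.
  apply: card_le_trans card_marked_groups.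
  have inj : {in \bigcap_n F n &, injective (@set_val _ P)} by move=> p q _ _ /val_inj.
  rewrite -(card_le_eql (inj_card_eq inj)); exact: subset_card_le.
(* For the lower bound, sets of naturals serve as branches of the Cantor scheme. *)
pose y (B : set nat) : set_type P :=
  exist _ (marked_incl (x (fun i => i \in B))) (mem_set (Px _)).
pose h (B : set nat) := qi_class R (set_val (y B)).
have h_inj : {in [set: set nat] &, injective h}.
  move=> B C _ _ hBC; apply: contrapT => BC.
  (* Equal classes would make one limit point a coarse retract of another. *)
  have [|k] := @coarse_retract_qi_class R n (x (fun i => i \in B)) (x (fun i => i \in C)).
    rewrite -[qi_class _ _]/(h B) hBC; exact: qi_class_refl.
  apply: x_ret => /funeqP bc; apply: BC; apply/seteqP; split=> i /mem_set.
    by rewrite bc => /set_mem.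
  by rewrite -bc => /set_mem.
rewrite -(card_le_eql (inj_card_eq h_inj)); apply: subset_card_le => _ [B _ <-].
by exists (y B) => // i _; exact: xF.
Qed.
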